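(* The integrality gap of the semidefinite program $\mathrm{SDP}_2$ (the symmetry-reduced QAP relaxation of the traveling salesman problem defined in the context) is at least $2$; that is, $$\sup_{D\in\mathcal{D}} \frac{\mathrm{OPT}_{\mathrm{TSP}}(D)}{\mathrm{OPT}_{\mathrm{SDP}_2}(D)}\ \ge\ 2 .$$
   Context: TSP: an instance on $N$ vertices is a symmetric matrix $D=(d_{ij})\in\mathbb{R}^{N\times N}$ with $d_{ij}\ge 0$, $d_{ii}=0$ and $d_{ij}\le d_{ik}+d_{kj}$ for all $i,j,k$ (distinct vertices may be at distance $0$). $\mathcal{D}$ is the set of all such matrices, over all $N\ge 3$. $\mathrm{OPT}_{\mathrm{TSP}}(D)$ is the minimum total cost of a Hamiltonian cycle in the complete graph $K_N$ with edge costs $d_{ij}$. Notation: $[m]=\{1,\dots,m\}$; $I_m$, $J_m$ are the $m\times m$ identity and all-ones matrices; $E^{(m)}_{jj}$ is the $m\times m$ matrix with a single $1$ in position $(j,j)$; $\mathbb{S}^{m\times m}$ is the set of real symmetric $m\times m$ matrices; $M[S,T]$ is the submatrix of $M$ with rows in $S$ and columns in $T$, and $M[S]=M[S,S]$; $\mathrm{Diag}(x)$ is the diagonal matrix with diagonal $x$; $\mathrm{vec}(M)$ stacks the columns of $M$; $\otimes$ is the Kronecker product; $Y\ge 0$ is entrywise nonnegativity and $Y\succeq 0$ is positive semidefiniteness. $C^{(N)}_1$ is the adjacency matrix of the $N$-cycle on $[N]$ with edges $\{i,i+1\}$ and $\{N,1\}$. $\mathrm{SDP}_2$: for an $N$-vertex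 instance $D$, put $n=N-1$, fix $r,s\in[n+1]$, and let $\alpha=[n+1]\setminus\{r\}$, $\beta=[n+1]\setminus\{s\}$, $\bar c=\mathrm{vec}\big(C^{(n+1)}_1[\alpha,\{r\}]\,D[\{s\},\beta]\big)\in\mathbb{R}^{n^2}$. Then $\mathrm{OPT}_{\mathrm{SDP}_2}(D)$ is the minimum of $$\mathrm{trace}\Big(\big(D[\beta]\otimes \tfrac12 C^{(n+1)}_1[\alpha]+\mathrm{Diag}(\bar c)\big)Y\Big)$$ over $Y\in\mathbb{S}^{n^2\times n^2}$ with $Y\ge 0$, $Y\succeq 0$ and (i) $\mathrm{trace}((I_n\otimes E^{(n)}_{jj})Y)=1$ for $j=1,\dots,n$; (ii) $\mathrm{trace}((E^{(n)}_{jj}\otimes I_n)Y)=1$ for $j=1,\dots,n$; (iii) $\mathrm{trace}\big((I_n\otimes(J_n-I_n)+(J_n-I_n)\otimes I_n)Y\big)=0$; (iv) $\mathrm{trace}((J_n\otimes J_n)Y)=n^2$. The choice of $r,s$ for each $N$ is arbitrary but fixed (one may take $r=s=1$). In the supremum, instances with $\mathrm{OPT}_{\mathrm{TSP}}(D)=0$ are disregarded, and a ratio with positive numerator and zero denominator is read as $+\infty$. *)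

(* Defs.v *)
From HB Require Import structures.
From mathcomp Require Import all_boot all_order all_algebra all_fingroup.
From mathcomp Require Import mxtens.
From mathcomp Require Import all_classical all_reals all_analysis.

Set Implicit Arguments.
Unset Strict Implicit.
Unset Printing Implicit Defensive.

Import Order.TTheory GRing.Theory Num.Theory.

Local Open Scope classical_set_scope.
Local Open Scope ring_scope.

Definition tsp_instance (R : realType) (N : nat) (D : 'M[R]_N) : Prop :=
  [/\ D^T = D,
      forall i j, 0 <= D i j,
      forall i, D i i = 0 &
      forall i j k, D i j <= D i k + D k j].

(* A Hamiltonian cycle of K_N (N >= 3) is given by a cyclic ordering t of the
   vertices: it visits t 0, t 1, ..., t (N-1) and returns to t 0. *)
Definition tour_cost (R : realType) (N : nat) (D : 'M[R]_N) (t : 'S_N) : R :=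
  \sum_(i < N) D (t i) (t (ordS i)).

Definition opt_tsp (R : realType) (N : nat) (D : 'M[R]_N) : R :=
  tour_cost D [arg min_(t < (1%g : 'S_N)) tour_cost D t]%O.

Definition cycle_adj (R : realType) (N : nat) : 'M[R]_N :=
  \matrix_(i, j) ((j == ordS i) || (i == ordS j))%:R.

(* Column-stacking vectorisation: entry (i, j) of M has position j * m + i.
   This is the indexing used by the Kronecker product tensmx, so the first
   Kronecker factor acts on column indices and the second on row indices. *)
Definition vec (R : realType) (m n : nat) (M : 'M[R]_(m, n)) : 'cV[R]_(n * m) :=
  \col_k M (mxtens_unindex k).2 (mxtens_unindex k).1.

Definition psdmx (R : realType) (m : nat) (Y : 'M[R]_m) : Prop :=
  Y^T = Y /\ forall x : 'cV[R]_m, 0 <= (x^T *m Y *m x) 0 0.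

(* M[S, S] for S the complement of {k}. *)
Definition delete (R : realType) (n : nat) (k : 'I_n.+1) (M : 'M[R]_n.+1) :
    'M[R]_n :=
  row' k (col' k M).

Section SDP2.
Variables (R : realType) (n : nat).

Let I_ : 'M[R]_n := 1%:M.
Let J_ : 'M[R]_n := const_mx 1.
Let E_ (j : 'I_n) : 'M[R]_n := delta_mx j j.

Definition sdp2_feasible (Y : 'M[R]_(n * n)) : Prop :=
  [/\ forall i j, 0 <= Y i j,
      psdmx Y,
      (forall j, \tr (tensmx I_ (E_ j) *m Y) = 1) /\
      (forall j, \tr (tensmx (E_ j) I_ *m Y) = 1),
      \tr ((tensmx I_ (J_ - I_) + tensmx (J_ - I_) I_) *m Y) = 0 &
      \tr (tensmx J_ J_ *m Y) = n%:R ^+ 2].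

Variables (r s : 'I_n.+1) (D : 'M[R]_n.+1).

Definition sdp2_cbar : 'cV[R]_(n * n) :=
  vec (col r (row' r (cycle_adj R n.+1)) *m row s (col' s D)).

Definition sdp2_obj (Y : 'M[R]_(n * n)) : R :=
  \tr ((tensmx (delete s D) (2^-1 *: delete r (cycle_adj R n.+1))
        + diag_mx sdp2_cbar^T) *m Y).

(* For n >= 2 the feasible set is nonempty (it contains the rank-one matrices
   of permutations) and compact, so this infimum is a finite minimum. *)
Definition opt_sdp2 : \bar R :=
  ereal_inf [set (sdp2_obj Y)%:E | Y in [set Y | sdp2_feasible Y]].

End SDP2.

(* N = n.+1 >= 3 vertices; r n and s n are the indices fixed for that size.
   Inversion in \bar R satisfies 0^-1 = +oo, so that a positive optimal tour
   cost divided by a zero bound is +oo. *)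
Definition sdp2_integrality_gap (R : realType)
    (r s : forall n : nat, 'I_n.+1) : \bar R :=
  ereal_sup [set q : \bar R | exists (n : nat) (D : 'M[R]_n.+1),
    [/\ (3 <= n.+1)%N, tsp_instance D, opt_tsp D != 0 &
        q = ((opt_tsp D)%:E / opt_sdp2 (r n) (s n) D)%E]].

(* Main.v *)
Require Import Defs.
From mathcomp Require Import all_boot all_order all_algebra all_fingroup.
From mathcomp Require Import mxtens.
From mathcomp Require Import all_classical all_reals all_analysis.
From mathcomp Require Import ring lra zify.

(* The instances are cut metrics: a set W of q out of n = N - 1 vertices, not
   containing the fixed vertex s, is at distance 1 from all other vertices, and
   all other distances are 0.  A tour crosses the cut at least twice, so it costs
   at least 2.

   Averaging Y over the permutations preserving W reduces it to the matrix V of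
   pseudo-probabilities that positions i and j are both occupied by W.  Since Y
   is a combination of tensor products of Gram matrices with Laplacians of
   nonnegative matrices and with V - (q/n)^2 J, it is feasible as soon as V is
   nonnegative, has diagonal q/n (dominating all entries) and row sums q^2/n,
   and V - (q/n)^2 J is positive semidefinite; its cost is
   the sum of 2(q/n - V_{i,i+1}) along the positions, plus at most 2q/n for the
   two neighbours of the fixed position.

   The cyclic autocorrelation V of a nonnegative sequence h, suitably scaled, has
   all these properties when (sum h)^2 = q (sum h^2), and costs at most
   q (sum of squared increments of h) / (sum h^2) + 2q/n.  A slowly varying h of
   short support makes this small: the trapezoid 1,2,3,4,5,5,5,5,4,3,2,1
   followed by zeros, with q = 10 and n = 80, gives 10/16 + 1/4 < 1. *)

Set Implicit Arguments.
Unset Strict Implicit.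
Unset Printing Implicit Defensive.

(** * Positive semidefinite matrices: closure properties, tensor products and Laplacians *)

Section PositiveSemidefinite.
Import Order.TTheory GRing.Theory Num.Theory.
Local Open Scope ring_scope.
Variable R : realType.

Lemma qformE n (M : 'M[R]_n) (x : 'cV_n) :
  (x^T *m M *m x) 0 0 = \sum_i \sum_j x i 0 * M i j * x j 0.
Proof.
rewrite mxE exchange_big; apply: eq_bigr => j _.
by rewrite mxE mulr_suml; apply: eq_bigr => i _; rewrite mxE.
Qed.

Lemma psdmxD n (A B : 'M[R]_n) : psdmx A -> psdmx B -> psdmx (A + B).
Proof.
move=> [As Ap] [Bs Bp]; split; first by rewrite linearD /= As Bs.
by move=> x; rewrite mulmxDr mulmxDl mxE addr_ge0.
Qed.

Lemma psdmxZ n (c : R) (A : 'M[R]_n) : 0 <= c -> psdmx A -> psdmx (c *: A).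
Proof.
move=> c0 [As Ap]; split; first by rewrite linearZ /= As.
by move=> x; rewrite -scalemxAr -scalemxAl mxE mulr_ge0.
Qed.

Lemma psdmx_congr m n (K : 'M[R]_(m, n)) (M : 'M[R]_n) :
  psdmx M -> psdmx (K *m M *m K^T).
Proof.
move=> [Ms Mp]; split; first by rewrite !trmx_mul trmxK Ms mulmxA.
by move=> x; have := Mp (K^T *m x); rewrite trmx_mul trmxK !mulmxA.
Qed.

Lemma sum_mxtens m n (F : 'I_(m * n) -> R) :
  \sum_k F k = \sum_a \sum_i F (mxtens_index (a, i)).
Proof.
rewrite pair_big; apply: (reindex (fun p => mxtens_index (p.1, p.2))).
exists (@mxtens_unindex m n) => [[a i] _|k _]; first by rewrite mxtens_indexK.
by rewrite -[RHS]mxtens_unindexK; case: (mxtens_unindex k).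
Qed.

Lemma mxtrace_tens_mul m n (A : 'M[R]_m) (B : 'M[R]_n) (Y : 'M[R]_(m * n)) :
  \tr ((A *t B) *m Y) = \sum_a \sum_i \sum_b \sum_j
    A a b * B i j * Y (mxtens_index (b, j)) (mxtens_index (a, i)).
Proof.
rewrite /mxtrace sum_mxtens; apply: eq_bigr => a _; apply: eq_bigr => i _.
rewrite mxE sum_mxtens; apply: eq_bigr => b _; apply: eq_bigr => j _.
by rewrite tensmxE.
Qed.

Lemma sum_tensmx m n (A : 'M[R]_m) (B : 'M[R]_n) :
  \sum_k \sum_l (A *t B) k l
    = (\sum_a \sum_b A a b) * (\sum_i \sum_j B i j).
Proof.
rewrite sum_mxtens mulr_suml; apply: eq_bigr => a _; rewrite mulr_sumr.
apply: eq_bigr => i _; rewrite sum_mxtens mulr_suml; apply: eq_bigr => b _.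
by rewrite mulr_sumr; apply: eq_bigr => j _; rewrite tensmxE.
Qed.

(** The quadratic form splits into one form of M for each block of x. *)
Lemma psdmx_tens1 m n (M : 'M[R]_n) :
  psdmx M -> psdmx ((1%:M : 'M[R]_m) *t M).
Proof.
move=> [Ms Mp]; split; first by rewrite trmx_tens trmx1 Ms.
move=> x; pose X a : 'cV[R]_n := \col_i x (mxtens_index (a, i)) 0.
suff -> : (x^T *m (1%:M *t M) *m x) 0 0 = \sum_a ((X a)^T *m M *m X a) 0 0.
  by apply: sumr_ge0 => a _; apply: Mp.
rewrite qformE sum_mxtens; apply: eq_bigr => a _.
rewrite qformE; apply: eq_bigr => i _.
rewrite sum_mxtens (bigD1 a) //= [X in _ + X]big1 ?addr0.
  by apply: eq_bigr => j _; rewrite tensmxE !mxE eqxx mul1r.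
move=> b ba; apply: big1 => j _.
by rewrite tensmxE !mxE eq_sym (negbTE ba) mul0r mulr0 mul0r.
Qed.

(** This is the congruence of I tensor M by K tensor I; writing the first factor as a Gram matrix
    avoids any spectral argument. *)
Lemma psdmx_tens_gram m n k (K : 'M[R]_(m, k)) (M : 'M[R]_n) :
  psdmx M -> psdmx ((K *m K^T) *t M).
Proof.
move=> /(@psdmx_tens1 k) /(psdmx_congr (K *t 1%:M)).
by rewrite trmx_tens trmx1 !tensmx_mul mulmx1 mul1mx mulmx1.
Qed.

Lemma psdmx1 n : psdmx (1%:M : 'M[R]_n).
Proof.
split; first exact: trmx1.
move=> x; rewrite mulmx1 mxE; apply: sumr_ge0 => i _.
by rewrite mxE -expr2 sqr_ge0.
Qed.

Lemma psdmx_gram m n (K : 'M[R]_(m, n)) : psdmx (K *m K^T).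
Proof. by have := psdmx_congr K (psdmx1 n); rewrite mulmx1. Qed.

Lemma psdmx_const1 n : psdmx (const_mx 1 : 'M[R]_n).
Proof.
have <- : (const_mx 1 : 'cV[R]_n) *m (const_mx 1)^T = const_mx 1 :> 'M[R]_n.
  by apply/matrixP => i j; rewrite !mxE big_ord1 !mxE mulr1.
exact: psdmx_gram.
Qed.

(* Twice the quadratic form is [\sum_i \sum_j M i j * (x i - x j) ^+ 2]. *)
Lemma psdmx_laplacian n (M : 'M[R]_n) (d : R) :
    M^T = M -> (forall i j, 0 <= M i j) -> (forall i, \sum_j M i j = d) ->
  psdmx (d%:M - M).
Proof.
move=> Ms M0 Md; split; first by rewrite linearB /= tr_scalar_mx Ms.
move=> x.
have Mc j : \sum_i M i j = d.
  by rewrite -(Md j); apply: eq_bigr => i _; rewrite -{1}Ms mxE.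
pose S := \sum_i \sum_j x i 0 * M i j * x j 0.
have E : (x^T *m (d%:M - M) *m x) 0 0 = \sum_i d * x i 0 ^+ 2 - S.
  rewrite mulmxBr mulmxBl [in LHS]mxE [X in _ + X]mxE (qformE M); congr (_ - _).
  rewrite mul_mx_scalar -scalemxAl mxE mxE mulr_sumr.
  by apply: eq_bigr => i _; rewrite mxE expr2.
suff : 0 <= 2 * (x^T *m (d%:M - M) *m x) 0 0 by rewrite pmulr_rge0.
suff -> : 2 * (x^T *m (d%:M - M) *m x) 0 0 =
    \sum_i \sum_j M i j * (x i 0 - x j 0) ^+ 2.
  by do 2!apply: sumr_ge0 => ? _; rewrite mulr_ge0 ?sqr_ge0.
have E1 : \sum_i \sum_j M i j * x i 0 ^+ 2 = \sum_i d * x i 0 ^+ 2.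
  by apply: eq_bigr => i _; rewrite -mulr_suml Md.
have E2 : \sum_i \sum_j M i j * x j 0 ^+ 2 = \sum_i d * x i 0 ^+ 2.
  by rewrite exchange_big; apply: eq_bigr => i _; rewrite -mulr_suml Mc.
rewrite E mulrBr mulr_natl mulr2n -{1}E1 -E2 /S -big_split mulr_sumr -sumrB.
apply: eq_bigr => i _; rewrite -big_split mulr_sumr -sumrB.
by apply: eq_bigr => j _ /=; ring.
Qed.

End PositiveSemidefinite.

(** * Indicators and the centering projection of a vertex set *)

Section Centering.
Import Order.TTheory GRing.Theory Num.Theory.
Local Open Scope ring_scope.
Variables (R : realType) (n : nat).
Implicit Type W : {set 'I_n}.

Definition indic W (a : 'I_n) : R := (a \in W)%:R.

Lemma sum_indic W : \sum_a indic W a = #|W|%:R.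
Proof. by rewrite /indic -natr_sum -sum1_card [in RHS]big_mkcond. Qed.

Lemma indicC W a : indic (~: W) a = 1 - indic W a.
Proof. by rewrite /indic inE; case: (a \in W); rewrite ?subrr ?subr0. Qed.

Lemma indic_idem W a : indic W a * indic W a = indic W a.
Proof. by rewrite /indic; case: (a \in W); rewrite ?mulr1 ?mulr0. Qed.

Lemma sum_delta (f : 'I_n -> R) a : \sum_b (a == b)%:R * f b = f a.
Proof.
rewrite (bigD1 a) //= eqxx mul1r big1 ?addr0 // => b ba.
by rewrite eq_sym (negbTE ba) mul0r.
Qed.

(** For nonempty W, the orthogonal projection onto the vectors supported on W with zero sum. *)
Definition centering W : 'M[R]_n :=
  \matrix_(a, b) (indic W a * indic W b * ((a == b)%:R - #|W|%:R^-1)).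

(** A symmetric idempotent is its own Gram matrix, the form that [psdmx_tens_gram] accepts. *)
Lemma centering_gram W : (0 < #|W|)%N ->
  centering W *m (centering W)^T = centering W.
Proof.
move=> W0; have q0 : #|W|%:R != 0 :> R by rewrite pnatr_eq0 -lt0n.
apply/matrixP => a b; rewrite !mxE; set q := #|W|%:R in q0 *.
transitivity (indic W a * indic W b * \sum_c
   ((a == c)%:R * ((b == c)%:R * indic W c) - (a == c)%:R * (q^-1 * indic W c)
    - (b == c)%:R * (q^-1 * indic W c) + q^-1 ^+ 2 * indic W c)).
  rewrite mulr_sumr; apply: eq_bigr => c _; rewrite !mxE -/q.
  rewrite -[in RHS](indic_idem W c); ring.
rewrite big_split !sumrB /= !sum_delta -mulr_sumr sum_indic -/q eq_sym.
have := indic_idem W a; have := indic_idem W b; rewrite /indic.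
case: (a \in W); case: (b \in W) => _ _; rewrite ?mul0r ?mulr0 ?mul0r //.
by rewrite /= ; field.
Qed.

Lemma sum_centering W : (0 < #|W|)%N -> \sum_a \sum_b centering W a b = 0.
Proof.
move=> W0; have q0 : #|W|%:R != 0 :> R by rewrite pnatr_eq0 -lt0n.
apply: big1 => a _.
transitivity (indic W a * (\sum_b (a == b)%:R * indic W b
    - #|W|%:R^-1 * \sum_b indic W b)).
  by rewrite mulr_sumr -sumrB mulr_sumr; apply: eq_bigr => b _; rewrite mxE; ring.
rewrite sum_delta sum_indic mulVf // /indic.
by case: (a \in W); rewrite ?mul0r // subrr mulr0.
Qed.

End Centering.

(** * Cut metrics and the cost of their tours *)

Section Cuts.
Import Order.TTheory GRing.Theory Num.Theory.
Local Open Scope ring_scope.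
Variable R : realType.

Definition cut_metric N (u : 'I_N -> bool) : 'M[R]_N :=
  \matrix_(i, j) (u i != u j)%:R.

(** The vertices other than s are indexed by ['I_n] through [lift s], as in the deleted matrix of
    the SDP; s itself lies outside W. *)
Definition side n (s : 'I_n.+1) (W : {set 'I_n}) (x : 'I_n.+1) : bool :=
  if unlift s x is Some a then a \in W else false.

Lemma cut_metric_instance N (u : 'I_N -> bool) : tsp_instance (cut_metric u).
Proof.
split=> [|i j|i|i j k]; first by apply/matrixP => i j; rewrite !mxE eq_sym.
- by rewrite mxE ler0n.
- by rewrite mxE eqxx.
by rewrite !mxE -natrD ler_nat; case: (u i); case: (u j); case: (u k).
Qed.

Lemma deleteE n (k : 'I_n.+1) (M : 'M[R]_n.+1) i j :
  delete k M i j = M (lift k i) (lift k j).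
Proof. by rewrite !mxE. Qed.

Lemma val_iter_ordS N k (i : 'I_N) : val (iter k (@ordS N) i) = ((i + k) %% N)%N.
Proof.
elim: k => [|k IHk] /=; first by rewrite addn0 modn_small.
by rewrite IHk -addn1 modnDml addn1 addnS.
Qed.

(** Without such a k, f would propagate along the cycle from i to j. *)
Lemma ordS_exit N (f : pred 'I_N) i j :
  f i -> ~~ f j -> exists k, f k && ~~ f (ordS k).
Proof.
move=> fi fj; apply/existsP; apply: contraNT fj => /existsPn Hf.
(* Adding N before subtracting i avoids a truncated subtraction when j < i. *)
suff -> : j = iter (j + (N - i))%N (@ordS N) i.
  elim: (_ + _)%N => // k IHk.
  by have := Hf (iter k (@ordS N) i); rewrite IHk /= negbK.
apply: val_inj; rewrite val_iter_ordS addnCA subnKC ?modnDr; last first.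
  exact: ltnW.
by rewrite modn_small.
Qed.

(* A cyclic sequence which is not constant both leaves and enters its support. *)
Lemma cut_metric_tour N (u : 'I_N -> bool) (t : 'S_N) x y :
  u x -> ~~ u y -> 2 <= tour_cost (cut_metric u) t.
Proof.
move=> ux uy; pose f i := u (t i).
have fx : f (t^-1%g x) by rewrite /f permKV.
have fy : ~~ f (t^-1%g y) by rewrite /f permKV.
have -> : tour_cost (cut_metric u) t =
    \sum_i (f i && ~~ f (ordS i))%:R + \sum_i (~~ f i && ~~ ~~ f (ordS i))%:R.
  rewrite -big_split; apply: eq_bigr => i _; rewrite mxE -/(f i) -/(f (ordS i)).
  by case: (f i); case: (f (ordS i)); rewrite /= ?addr0 ?add0r.
have ge1 (g : pred 'I_N) : (exists i, g i) -> 1 <= \sum_i (g i)%:R :> R.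
  move=> [i gi]; rewrite (bigD1 i) //= gi lerDl.
  by apply: sumr_ge0 => j _; rewrite ler0n.
rewrite -[leLHS]/(1 + 1) lerD //; apply: ge1; first exact: ordS_exit fx fy.
by apply: (@ordS_exit _ (predC f) _ _ fy); rewrite /= negbK; apply: fx.
Qed.

Lemma side0 n (s : 'I_n.+1) W : side s W s = false.
Proof. by rewrite /side unlift_none. Qed.

Lemma side_lift n (s : 'I_n.+1) W a : side s W (lift s a) = (a \in W).
Proof. by rewrite /side liftK. Qed.

Lemma cut_metric_lift n (s : 'I_n.+1) W a b :
  cut_metric (side s W) (lift s a) (lift s b) =
  indic R W a * indic R (~: W) b + indic R (~: W) a * indic R W b.
Proof.
rewrite mxE !side_lift /indic !inE.
by case: (a \in W); case: (b \in W);
  rewrite /= ?mul0r ?mulr0 ?mulr1 ?addr0 ?add0r.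
Qed.

Lemma cut_metric_lift0 n (s : 'I_n.+1) W a :
  cut_metric (side s W) s (lift s a) = indic R W a.
Proof. by rewrite mxE side0 side_lift /indic; case: (a \in W). Qed.

End Cuts.

(** * A feasible SDP matrix built from position correlations V *)

Section FractionalBisection.
Import Order.TTheory GRing.Theory Num.Theory.
Local Open Scope ring_scope.
Variables (R : realType) (n : nat) (W : {set 'I_n}) (V : 'M[R]_n).

Let q : R := #|W|%:R.
Let p : R := #|~: W|%:R.
Let y : R := q / n%:R.

Hypotheses (q_gt1 : (1 < #|W|)%N) (p_gt1 : (1 < #|~: W|)%N).
Hypotheses (V_sym : V^T = V) (V_ge0 : forall i j, 0 <= V i j).
Hypotheses (V_le : forall i j, V i j <= y) (V_diag : forall i, V i i = y).
Hypotheses (V_row : forall i, \sum_j V i j = q * y).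
Hypotheses (V_psd : psdmx (V - const_mx (y ^+ 2))) (y_le : 2 * y <= 1).

(** The contrast between the averages over W and over its complement. With the ranges of the two
    centerings and the constants, it spans all vectors: the splitting under permutations preserving
    W, which dictates the four summands below. *)
Let w : 'cV[R]_n := \col_a (indic R W a / q - indic R (~: W) a / p).

(* In [bisection_sdpE]: two distinct vertices a, b occupy two distinct positions
   i, j with pseudo-probability V i j / (q (q - 1)) if both are in W,
   (y - V i j) / (p q) if exactly one is, and (1 - 2 y + V i j) / (p (p - 1))
   if none is. *)
Definition bisection_sdp : 'M[R]_(n * n) :=
  (q * (q - 1))^-1 *: (centering R W *t ((q * y)%:M - V))
  + (p * (p - 1))^-1 *:
      (centering R (~: W) *t ((p * (1 - y))%:M - (const_mx (1 - 2 * y) + V)))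
  + (w *m w^T) *t (V - const_mx (y ^+ 2))
  + const_mx (n%:R ^- 2).
Local Notation Y := bisection_sdp.

Let pq : p + q = n%:R.
Proof. by rewrite /p /q -natrD addnC cardsC card_ord. Qed.
Let q1 : 1 < q. Proof. by rewrite /q ltr1n. Qed.
Let p1 : 1 < p. Proof. by rewrite /p ltr1n. Qed.
Let q_gt0 : 0 < q. Proof. exact: lt_trans ltr01 q1. Qed.
Let p_gt0 : 0 < p. Proof. exact: lt_trans ltr01 p1. Qed.
Let n_gt0 : 0 < n%:R :> R. Proof. by rewrite -pq addr_gt0. Qed.
Let n_neq0 : n%:R != 0 :> R. Proof. by rewrite gt_eqF. Qed.
Let qq1_ge0 : 0 <= (q * (q - 1))^-1.
Proof. by rewrite invr_ge0 mulr_ge0 ?ltW ?subr_gt0. Qed.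
Let pp1_ge0 : 0 <= (p * (p - 1))^-1.
Proof. by rewrite invr_ge0 mulr_ge0 ?ltW ?subr_gt0. Qed.

(** The definition displays positive semidefiniteness; this form gives the signs, the zero pattern
    and the cost. *)
Lemma bisection_sdpE a i b j :
  Y (mxtens_index (a, i)) (mxtens_index (b, j)) =
    if a == b then (i == j)%:R / n%:R else if i == j then 0 else
    V i j * (indic R W a * indic R W b) / (q * (q - 1))
    + (1 - 2 * y + V i j) * (indic R (~: W) a * indic R (~: W) b)
      / (p * (p - 1))
    + (y - V i j) * (indic R W a * indic R (~: W) b
      + indic R (~: W) a * indic R W b) / (p * q).
Proof.
rewrite /Y mxE [X in X + _]mxE [X in X + _ + _]mxE [X in X + _ + _ + _]mxE.
rewrite [X in _ + X + _ + _]mxE !tensmxE !mxE big_ord1 !mxE !indicC.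
(* With n written as p + q, each case is a rational identity in p and q. *)
rewrite -/q -/p /y -pq.
have := V_diag i; rewrite /y -pq.
move: q1 p1; move: q p => Q P Q1 P1.
have [Q0 P0 Q10 P10 PQ0] :
    [/\ Q != 0, P != 0, Q - 1 != 0, P - 1 != 0 & P + Q != 0].
  by split; apply/eqP; lra.
rewrite /indic.
have [->|ij] := eqVneq i j; last move=> _; [move=> ->|].
all: have [->|ab] := eqVneq a b;
  rewrite ?mulr1n ?mulr0n ?mulr1 ?mulr0 ?mul1r ?mul0r.
- case: (b \in W); rewrite /=; field; by rewrite ?Q0 ?P0 ?Q10 ?P10 ?PQ0.
- case: (a \in W); case: (b \in W); rewrite /=; field;
  by rewrite ?Q0 ?P0 ?Q10 ?P10 ?PQ0.
- case: (b \in W); rewrite /=; field; by rewrite ?Q0 ?P0 ?Q10 ?P10 ?PQ0.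
- case: (a \in W); case: (b \in W); rewrite /=; field;
  by rewrite ?Q0 ?P0 ?Q10 ?P10 ?PQ0.
Qed.

(** The first two summands involve Laplacians: V has row sums q y, and (1 - 2 y) J + V has row sums
    n (1 - 2 y) + q y = p (1 - y). *)
Lemma bisection_sdp_psd : psdmx Y.
Proof.
have qn : q = y * n%:R by rewrite /y mulfVK.
have pn : p = (1 - y) * n%:R by rewrite mulrBl mul1r -qn -pq addrK.
have cW := centering_gram R (ltnW q_gt1).
have cU := centering_gram R (ltnW p_gt1).
do 3?apply: psdmxD.
- apply: psdmxZ => //.
  rewrite -cW; apply: psdmx_tens_gram; exact: psdmx_laplacian.
- apply: psdmxZ => //.
  rewrite -cU; apply: psdmx_tens_gram; apply: psdmx_laplacian.
  + by rewrite linearD /= V_sym trmx_const.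
  + by move=> i j; rewrite !mxE addr_ge0 ?subr_ge0.
  move=> i; under eq_bigr => j _ do rewrite !mxE.
  rewrite big_split /= V_row sumr_const card_ord -mulr_natr pn {1}qn; ring.
- exact: psdmx_tens_gram.
have -> : const_mx (n%:R ^- 2) = n%:R ^- 2 *: const_mx 1 :> 'M[R]_(n * n).
  by apply/matrixP => i j; rewrite !mxE mulr1.
by apply: psdmxZ; [rewrite invr_ge0 exprn_ge0 ?ler0n | apply: psdmx_const1].
Qed.

Lemma bisection_sdp_ge0 k l : 0 <= Y k l.
Proof.
case: (mxtens_indexP k) => a i; case: (mxtens_indexP l) => b j.
rewrite bisection_sdpE; case: eqP => _; first by rewrite divr_ge0 ?ler0n ?ltW.
case: eqP => _ //.
have := V_ge0 i j; have := V_le i j; set v := V i j => vy v0.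
have ind0 S c : 0 <= indic R S c by rewrite /indic ler0n.
have v1 : 0 <= 1 - 2 * y + v by rewrite addr_ge0 ?subr_ge0.
have v2 : 0 <= y - v by rewrite subr_ge0.
have pq0 : 0 <= (p * q)^-1 by rewrite invr_ge0 mulr_ge0 ?ltW.
by rewrite !addr_ge0 // mulr_ge0 // mulr_ge0 // ?addr_ge0 // mulr_ge0.
Qed.

Lemma bisection_sdp_diag a i :
  Y (mxtens_index (a, i)) (mxtens_index (a, i)) = n%:R^-1.
Proof. by rewrite bisection_sdpE !eqxx mul1r. Qed.

(** Only the constant summand contributes: the first tensor factors of the others have total sum
    0. *)
Lemma sum_bisection_sdp : \sum_k \sum_l Y k l = n%:R ^+ 2.
Proof.
have [q0 p0] : q != 0 /\ p != 0 by rewrite !gt_eqF.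
have sumw : \sum_a w a 0 = 0.
  under eq_bigr => a _ do rewrite mxE.
  by rewrite sumrB -!mulr_suml !sum_indic -/p -/q !divff ?subrr.
have sumww : \sum_a \sum_b (w *m w^T) a b = 0.
  apply: big1 => a _; transitivity (w a 0 * \sum_b w b 0).
    by rewrite mulr_sumr; apply: eq_bigr => b _; rewrite mxE big_ord1 !mxE.
  by rewrite sumw mulr0.
have sumD (A B : 'M[R]_(n * n)) : \sum_k \sum_l (A + B) k l =
    \sum_k \sum_l A k l + \sum_k \sum_l B k l.
  rewrite -big_split; apply: eq_bigr => k _ /=; rewrite -big_split.
  by apply: eq_bigr => l _; rewrite mxE.
have sumZ c (A : 'M[R]_(n * n)) : \sum_k \sum_l (c *: A) k l =
    c * \sum_k \sum_l A k l.
  rewrite mulr_sumr; apply: eq_bigr => k _; rewrite mulr_sumr.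
  by apply: eq_bigr => l _; rewrite mxE.
rewrite /Y !sumD !sumZ !sum_tensmx !(sum_centering _ (ltnW _)) //.
rewrite sumww !mul0r !mulr0 !add0r.
under eq_bigr => k _ do [under eq_bigr => l _ do rewrite mxE].
rewrite !sumr_const !card_ord -mulrnA -[LHS]mulr_natr !natrM.
by rewrite -(expr2 n%:R) mulrA mulVf ?mul1r // expf_neq0.
Qed.

Lemma bisection_sdp_feasible : sdp2_feasible Y.
Proof.
split; first exact: bisection_sdp_ge0.
- exact: bisection_sdp_psd.
- split=> j0; rewrite mxtrace_tens_mul.
  (* The coefficient matrix is diagonal, so only diagonal entries of Y survive, each equal to
     1/n. *)
  + transitivity (\sum_(a < n) \sum_(i < n) (j0 == i)%:R * n%:R^-1 : R).
      apply: eq_bigr => a _; apply: eq_bigr => i _.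
      rewrite (bigD1 a) //= [X in _ + X]big1 ?addr0 => [|b ba]; last first.
        apply: big1 => j _; by rewrite !mxE eq_sym (negbTE ba) !mul0r.
      rewrite (bigD1 i) //= [X in _ + X]big1 ?addr0 => [|j ji]; last first.
        rewrite !mxE; have [ij0|_] := eqVneq i j0; last by rewrite mulr0 mul0r.
        by rewrite -ij0 (negbTE ji) mulr0 mul0r.
      by rewrite bisection_sdp_diag !mxE eqxx ?mul1r ?mulr1 andbb eq_sym.
    under eq_bigr => a _ do rewrite sum_delta.
    by rewrite sumr_const card_ord -[LHS]mulr_natr mulVf.
  + transitivity (\sum_(a < n) \sum_(i < n) (j0 == a)%:R * n%:R^-1 : R).
      apply: eq_bigr => a _; apply: eq_bigr => i _.
      rewrite (bigD1 a) //= [X in _ + X]big1 ?addr0 => [|b ba]; last first.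
        apply: big1 => j _; rewrite !mxE; have [aj0|_] := eqVneq a j0;
          last by rewrite !mul0r.
        by rewrite -aj0 (negbTE ba) !mul0r.
      rewrite (bigD1 i) //= [X in _ + X]big1 ?addr0 => [|j ji]; last first.
        by rewrite !mxE (eq_sym i) (negbTE ji) mulr0 mul0r.
      by rewrite bisection_sdp_diag !mxE eqxx ?mul1r ?mulr1 andbb eq_sym.
    rewrite exchange_big; under eq_bigr => i _ do rewrite sum_delta.
    by rewrite sumr_const card_ord -[LHS]mulr_natr mulVf.
(* A coefficient is nonzero only if exactly one of a = b, i = j holds, and there Y vanishes. *)
- rewrite mulmxDl linearD /= !mxtrace_tens_mul.
  rewrite !big1 ?add0r // => a _;
    apply: big1 => i _; apply: big1 => b _; apply: big1 => j _;
    rewrite bisection_sdpE !mxE (eq_sym b) (eq_sym j);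
    case: (a == b); case: (i == j);
    by rewrite /= ?mulr1n ?mulr0n ?subrr ?mul0r ?mulr0 ?mul0r.
rewrite mxtrace_tens_mul -sum_bisection_sdp [RHS]exchange_big [RHS]sum_mxtens.
apply: eq_bigr => a _; apply: eq_bigr => i _; rewrite sum_mxtens.
by apply: eq_bigr => b _; apply: eq_bigr => j _; rewrite !(@mxE R n n) !mul1r.
Qed.

(** The 2 p q ordered pairs across the cut cancel the factors 1/2 and 1/(p q). In the linear term
    each of the q vertices of W is at distance 1 from s and has diagonal weight 1/n. *)
Lemma bisection_sdp_obj (r s : 'I_n.+1) :
  sdp2_obj r s (cut_metric R (side s W)) Y =
  \sum_i \sum_j cycle_adj R n.+1 (lift r i) (lift r j) * (y - V i j)
  + (\sum_i cycle_adj R n.+1 (lift r i) r) * y.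
Proof.
have [q0 p0] : q != 0 /\ p != 0 by rewrite !gt_eqF.
rewrite /sdp2_obj mulmxDl linearD /=; congr (_ + _).
  rewrite mxtrace_tens_mul.
  set D := cut_metric R _; set C := cycle_adj _ _.
  have sumD : \sum_a \sum_b D (lift s a) (lift s b) = 2 * (p * q).
    transitivity (\sum_a (indic R W a * p + indic R (~: W) a * q)).
      apply: eq_bigr => a _; rewrite /p /q -!sum_indic !mulr_sumr -big_split.
      by apply: eq_bigr => b _; rewrite cut_metric_lift.
    by rewrite big_split -!mulr_suml !sum_indic -/p -/q /=; ring.
  transitivity ((\sum_a \sum_b D (lift s a) (lift s b)) *
      \sum_i \sum_j 2^-1 * C (lift r i) (lift r j) * ((y - V i j) / (p * q))).
    rewrite mulr_suml; apply: eq_bigr => a _.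
    rewrite mulr_sumr; apply: eq_bigr => i _.
    rewrite mulr_suml; apply: eq_bigr => b _.
    rewrite mulr_sumr; apply: eq_bigr => j _.
    have -> : (2^-1 *: delete r C) i j = 2^-1 * C (lift r i) (lift r j).
      by rewrite mxE deleteE.
    rewrite bisection_sdpE deleteE cut_metric_lift.
    have -> : V j i = V i j by rewrite -{1}V_sym mxE.
    have [->|ba] := eqVneq b a; first by rewrite /indic !inE;
      case: (a \in W); rewrite /= ?(mulr0, mul0r, addr0).
    (* The entry of Y is 0 here, and the common formula agrees because V i i = y. *)
    have [->|ji] := eqVneq j i; first by rewrite V_diag subrr !(mul0r, mulr0).
    rewrite /indic !inE; case: (a \in W); case: (b \in W);
      by rewrite /= ?(mulr1, mulr0, mul1r, mul0r, addr0, add0r).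
  rewrite sumD mulr_sumr; apply: eq_bigr => i _.
  rewrite mulr_sumr; apply: eq_bigr => j _.
  by field; rewrite q0 p0.
rewrite mul_diag_mx /mxtrace sum_mxtens.
transitivity (\sum_a (indic R W a *
  ((\sum_i cycle_adj R n.+1 (lift r i) r) / n%:R))).
  apply: eq_bigr => a _; rewrite mulr_suml mulr_sumr; apply: eq_bigr => i _.
  rewrite mxE bisection_sdp_diag.
  have -> : (sdp2_cbar r s (cut_metric R (side s W)))^T 0 (mxtens_index (a, i))
      = cycle_adj R n.+1 (lift r i) r * cut_metric R (side s W) s (lift s a).
    rewrite mxE /sdp2_cbar mxE mxtens_indexK /= mxE big_ord1.
    by congr (_ * _); rewrite mxE mxE.
  by rewrite cut_metric_lift0 mulrAC mulrC.
by rewrite -mulr_suml sum_indic -/q /y; ring.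
Qed.

End FractionalBisection.

(** * Deleting a position from the cycle *)

Section Positions.
Import Order.TTheory GRing.Theory Num.Theory.
Local Open Scope ring_scope.
Variable R : realType.

Lemma eq_ordS_lift n (r : 'I_n.+1) (i j : 'I_n) :
  lift r j == ordS (lift r i) -> j == ordS i.
Proof.
rewrite -!val_eqE /= /bump => Hij; apply/eqP; move/eqP: Hij.
have := ltn_ord i; have := ltn_ord j; have := ltn_ord r.
move: (val i) (val j) (val r) => {}i {}j {}r rn jn iN.
have [i1|i1] := ltnP i.+1 n.
  rewrite (modn_small i1) modn_small; first by do 2![case: leqP => ?]; lia.
  by case: leqP => ?; lia.
(* Now i is the last index: either its lift is n and wraps round to 0, or r = n is its successor,
   which no lift can equal. *)
have {i1 iN} En : n = i.+1 by lia.
rewrite En modnn; case: (leqP r i) => ri.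
  by rewrite add1n modnn; case: leqP; lia.
by rewrite modn_small; case: leqP; lia.
Qed.

(* Deleting position [r] from the (n+1)-cycle leaves a path, which is a subgraph
   of the n-cycle on the remaining positions. *)
Lemma cycle_adj_lift n (r : 'I_n.+1) (i j : 'I_n) :
  cycle_adj R n.+1 (lift r i) (lift r j) <= (j == ordS i)%:R + (i == ordS j)%:R.
Proof.
rewrite mxE -natrD ler_nat.
case: orP => // -[/eq_ordS_lift -> //|/eq_ordS_lift ->]; exact: leq_addl.
Qed.

Lemma sum_eq_const N (k : 'I_N) : \sum_i (i == k)%:R = 1 :> R.
Proof. by rewrite (bigD1 k) //= eqxx big1 ?addr0 // => i /negbTE ->. Qed.

Lemma cycle_adj_degree n (r : 'I_n.+1) :
  \sum_i cycle_adj R n.+1 (lift r i) r <= 2.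
Proof.
have adj0 i j : 0 <= cycle_adj R n.+1 i j by rewrite mxE ler0n.
have : \sum_i cycle_adj R n.+1 i r <= 2.
  have -> : 2 = \sum_i ((i == ord_pred r)%:R + (i == ordS r)%:R) :> R.
    by rewrite big_split !sum_eq_const.
  apply: ler_sum => i _; rewrite mxE -natrD ler_nat.
  case: orP => // -[/eqP ->|->]; last exact: leq_addl.
  by rewrite ordSK eqxx.
apply: le_trans; rewrite [leRHS](bigD1_ord r) //= lerDr; exact: adj0.
Qed.

End Positions.

(** * Cyclic autocorrelations as position correlations *)

Section Autocorrelation.
Import Order.TTheory GRing.Theory Num.Theory.
Local Open Scope ring_scope.
Variables (R : realType) (m : nat).
Local Notation n := m.+2.
Variables (h : 'I_n -> R) (W : {set 'I_n}).
Let q : R := #|W|%:R.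
Let A := \sum_t h t.
Let B := \sum_t h t ^+ 2.
Let E := \sum_t (h t - h (ordS t)) ^+ 2.
Let c : R := q / (n%:R * B).

Hypotheses (h_ge0 : forall t, 0 <= h t) (B_gt0 : 0 < B) (AB : A ^+ 2 = q * B).

(** The form [m.+2] makes ['I_n] the integers modulo n, so [i + t] is a cyclic shift. The scale c
    makes the diagonal q/n. *)
Definition autocorrelation : 'M[R]_n :=
  \matrix_(i, j) (c * \sum_t h (i + t) * h (j + t)).
Local Notation V := autocorrelation.

Let n_neq0 : n%:R != 0 :> R. Proof. by rewrite pnatr_eq0. Qed.
Let B_neq0 : B != 0. Proof. by rewrite gt_eqF. Qed.
Let cB : c * B = q / n%:R.
Proof. by rewrite /c invfM mulrA mulfVK. Qed.
Let c_ge0 : 0 <= c.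
Proof. by rewrite divr_ge0 ?mulr_ge0 ?ler0n ?ltW. Qed.

Let sum_shift (f : 'I_n -> R) i : \sum_t f (i + t) = \sum_t f t.
Proof. by rewrite [RHS](reindex_inj (addrI i)). Qed.

Let sum_sqr i : \sum_t h (i + t) ^+ 2 = B.
Proof. exact: (sum_shift (fun t => h t ^+ 2)). Qed.

Lemma autocorrelation_sym : V^T = V.
Proof.
by apply/matrixP => i j; rewrite !mxE; under eq_bigr do rewrite mulrC.
Qed.

Lemma autocorrelation_ge0 i j : 0 <= V i j.
Proof.
by rewrite mxE mulr_ge0 //; apply: sumr_ge0 => t _; rewrite mulr_ge0.
Qed.

Lemma autocorrelation_diag i : V i i = q / n%:R.
Proof.
rewrite mxE -cB; congr (_ * _).
exact: sum_sqr.
Qed.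

(** Polarization: all shifts of h have the same norm. This gives both the upper bound on V and the
    cost in terms of increments. *)
Lemma autocorrelation_defect i j :
  q / n%:R - V i j = c / 2 * \sum_t (h (i + t) - h (j + t)) ^+ 2.
Proof.
have -> : \sum_t (h (i + t) - h (j + t)) ^+ 2 =
    B + B - 2 * \sum_t h (i + t) * h (j + t).
  rewrite -{1}(sum_sqr i) -(sum_sqr j) mulr_sumr -big_split -sumrB.
  by apply: eq_bigr => t _ /=; ring.
by rewrite -cB mxE; field.
Qed.

Lemma autocorrelation_le i j : V i j <= q / n%:R.
Proof.
rewrite -subr_ge0 autocorrelation_defect.
apply: mulr_ge0; first by apply: divr_ge0.
by apply: sumr_ge0 => t _; rewrite sqr_ge0.
Qed.

(** Each row sums to c A^2, which the normalization A^2 = q B turns into q^2/n. *)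
Lemma autocorrelation_row i : \sum_j V i j = q * (q / n%:R).
Proof.
under eq_bigr => j _ do rewrite mxE.
rewrite -mulr_sumr exchange_big /=.
under eq_bigr => t _ do rewrite -mulr_sumr
  (eq_bigr (fun j => h (t + j)) (fun j _ => congr1 h (addrC j t))) sum_shift.
rewrite -mulr_suml sum_shift -/A -expr2 AB mulrCA cB; ring.
Qed.

Lemma autocorrelation_psd : psdmx (V - const_mx ((q / n%:R) ^+ 2)).
Proof.
(* The rows of K are the shifts of h minus their mean; the correction c A^2/n equals (q/n)^2, again
   by A^2 = q B. *)
pose K : 'M[R]_n := \matrix_(i, t) (h (i + t) - A / n%:R).
suff -> : V - const_mx ((q / n%:R) ^+ 2) = c *: (K *m K^T).
  by apply: psdmxZ => //; apply: psdmx_gram.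
apply/matrixP => i j; rewrite !mxE.
have -> : \sum_t K i t * K^T t j =
    \sum_t h (i + t) * h (j + t) - A / n%:R * (A + A) + A ^+ 2 / n%:R.
  transitivity (\sum_t (h (i + t) * h (j + t) - A / n%:R * (h (i + t) + h (j + t))
      + (A / n%:R) ^+ 2)).
    by apply: eq_bigr => t _; rewrite !mxE; ring.
  rewrite big_split sumrB -mulr_sumr big_split !sum_shift /= -/A.
  rewrite sumr_const card_ord -[X in _ + X]mulr_natr.
  by move: n_neq0; move: (n%:R) => N N0; field.
have -> : c = q / n%:R / B by rewrite -cB mulfK.
apply/eqP; rewrite -subr_eq0; apply/eqP.
transitivity (q / n%:R / (n%:R * B) * (A ^+ 2 - q * B)).
  by move: n_neq0; move: (n%:R) => N N0; field; rewrite N0 B_neq0.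
by rewrite AB subrr mulr0.
Qed.

Lemma autocorrelation_edges :
  \sum_i (q / n%:R - V i (ordS i)) = q / B * E / 2.
Proof.
have ordSE (t : 'I_n) : ordS t = t + 1.
  by apply: val_inj; rewrite /= modnDmr addn1.
under eq_bigr => i _ do rewrite autocorrelation_defect ordSE.
transitivity (\sum_(i < n) c / 2 * E).
  apply: eq_bigr => i _; congr (_ * _).
  rewrite -[RHS](sum_shift (fun t => (h t - h (ordS t)) ^+ 2) i).
  by apply: eq_bigr => t _; rewrite ordSE addrAC.
rewrite sumr_const card_ord -[LHS]mulr_natr /c.
by move: n_neq0; move: (n%:R) => N N0; field; rewrite N0 B_neq0.
Qed.

End Autocorrelation.

(** * Bounds on the SDP value of a cut metric *)

Section Gap.
Import Order.TTheory GRing.Theory Num.Theory.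
Local Open Scope ring_scope.
Variable R : realType.

Lemma opt_sdp2_le n (r s : 'I_n.+1) (D : 'M[R]_n.+1) (Y : 'M[R]_(n * n)) :
  sdp2_feasible Y -> (opt_sdp2 r s D <= (sdp2_obj r s D Y)%:E)%E.
Proof. by move=> Yf; apply: ereal_inf_lbound; exists Y. Qed.

(** All cost coefficients and entries of Y are nonnegative. This rules out a negative denominator in
    the ratio. *)
Lemma opt_sdp2_ge0 n (r s : 'I_n.+1) (D : 'M[R]_n.+1) :
  tsp_instance D -> (0 <= opt_sdp2 r s D)%E.
Proof.
move=> [_ D0 _ _]; apply: le_ereal_inf_tmp => _ [Y [Y0 _ _ _ _] <-].
rewrite lee_fin.
have C0 i j : 0 <= cycle_adj R n.+1 i j by rewrite mxE ler0n.
apply: sumr_ge0 => k _; rewrite mxE; apply: sumr_ge0 => l _.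
rewrite mulr_ge0 // mxE addr_ge0 //.
  rewrite mxE deleteE; apply: mulr_ge0; first exact: D0.
  rewrite mxE deleteE; apply: mulr_ge0; last exact: C0.
  by rewrite invr_ge0 ler0n.
rewrite mxE; apply: mulrn_wge0; rewrite mxE /sdp2_cbar mxE mxE big_ord1.
apply: mulr_ge0; rewrite mxE mxE; [exact: C0 | exact: D0].
Qed.

Lemma opt_sdp2_cut_le m (h : 'I_m.+2 -> R) (W : {set 'I_m.+2}) (r s : 'I_m.+3) :
    (1 < #|W|)%N -> (1 < #|~: W|)%N -> (2 * #|W| <= m.+2)%N ->
    (forall t, 0 <= h t) -> 0 < \sum_t h t ^+ 2 ->
    (\sum_t h t) ^+ 2 = #|W|%:R * \sum_t h t ^+ 2 ->
  (opt_sdp2 r s (cut_metric R (side s W)) <=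
    (#|W|%:R / (\sum_t h t ^+ 2) * (\sum_t (h t - h (ordS t)) ^+ 2)
     + 2 * (#|W|%:R / m.+2%:R))%:E)%E.
Proof.
move=> W1 W2 Wn h0 B0 AB; pose V := autocorrelation h W.
have y2 : 2 * (#|W|%:R / m.+2%:R) <= 1 :> R.
  by rewrite mulrA ler_pdivrMr ?ltr0n // mul1r -natrM ler_nat.
have Vf : sdp2_feasible (bisection_sdp W V).
  apply: bisection_sdp_feasible => //.
  - exact: autocorrelation_sym.
  - by move=> i j; apply: autocorrelation_ge0.
  - by move=> i j; apply: autocorrelation_le.
  - by move=> i; apply: autocorrelation_diag.
  - by move=> i; apply: autocorrelation_row.
  - exact: autocorrelation_psd.
apply: (le_trans (opt_sdp2_le r s _ Vf)); rewrite lee_fin.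
rewrite bisection_sdp_obj //; last 2 first.
- exact: autocorrelation_sym.
- by move=> i; apply: autocorrelation_diag.
apply: lerD; last first.
  by rewrite ler_wpM2r ?divr_ge0 ?ler0n // cycle_adj_degree.
set y := _ / m.+2%:R.
have Vs i j : V i j = V j i.
  by move/matrixP: (autocorrelation_sym h W) => /(_ j i); rewrite mxE.
(* Since y - V is nonnegative, the path may be completed to the n-cycle; its two orientations cancel
   the 1/2 in [autocorrelation_edges]. *)
apply: (@le_trans _ _ (\sum_i \sum_j
  ((j == ordS i)%:R + (i == ordS j)%:R) * (y - V i j))).
  apply: ler_sum => i _; apply: ler_sum => j _; rewrite ler_wpM2r //.
    by rewrite subr_ge0 autocorrelation_le.
  exact: cycle_adj_lift.
have delta i (f : 'I_m.+2 -> R) : \sum_j (j == i)%:R * f j = f i.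
  by rewrite -[RHS]sum_delta; apply: eq_bigr => j _; rewrite eq_sym.
under eq_bigr => i _ do
  (under eq_bigr => j _ do rewrite mulrDl; rewrite big_split /= delta).
rewrite big_split /= [X in _ + X]exchange_big /=.
under [X in _ + X]eq_bigr => j _ do rewrite delta Vs.
by rewrite autocorrelation_edges // -splitr.
Qed.

End Gap.

(** * The explicit instance on 81 vertices *)

Section Trapezoid.
Import Order.TTheory GRing.Theory Num.Theory.

(** Truncated subtraction makes the value 0 from t = 12 on. *)
Definition trapezoid (t : nat) : nat := minn (minn t.+1 (12 - t)) 5.

(** Turns a numerical sum over ordinals into a list sum that evaluates by conversion. *)
Lemma sum_ord_mkseq n (f : nat -> nat) : \sum_(i < n) f i = sumn (mkseq f n).
Proof. by rewrite sumnE big_map -(big_mkord xpredT f) /index_iota subn0. Qed.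

Local Open Scope ring_scope.
Variable R : realType.
Let h (t : 'I_80) : R := (trapezoid t)%:R.

Lemma sum_trapezoid : \sum_t h t = 40.
Proof. by rewrite -natr_sum sum_ord_mkseq. Qed.

Lemma sum_sqr_trapezoid : \sum_t h t ^+ 2 = 160.
Proof.
under eq_bigr do rewrite -natrX.
by rewrite -natr_sum (sum_ord_mkseq 80 (fun t => trapezoid t ^ 2)%N).
Qed.

Lemma sum_sqr_diff_trapezoid : \sum_t (h t - h (ordS t)) ^+ 2 = 10.
Proof.
(* One of the two truncated differences is 0, so the squares can be computed in [nat]. *)
have sqrB (a b : nat) :
    (a%:R - b%:R) ^+ 2 = ((a - b) ^ 2 + (b - a) ^ 2)%N%:R :> R.
  rewrite natrD !natrX; have [ab|/ltnW ba] := leqP a b.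
    by rewrite (eqP (ab : a - b == 0)%N) natrB // expr0n add0r -sqrrN opprB.
  by rewrite (eqP (ba : b - a == 0)%N) natrB // expr0n addr0.
pose g t := (t.+1 %% 80)%N.
under eq_bigr do rewrite sqrB.
by rewrite -natr_sum (sum_ord_mkseq 80 (fun t =>
  (trapezoid t - trapezoid (g t)) ^ 2 + (trapezoid (g t) - trapezoid t) ^ 2)%N).
Qed.

Let W : {set 'I_80} := [set a : 'I_80 | (a < 10)%N].

Lemma card_W : #|W| = 10%N.
Proof.
rewrite -sum1_card big_mkcond /=.
under eq_bigr do rewrite inE.
by rewrite (sum_ord_mkseq 80 (fun a => if a < 10 then 1 else 0)%N).
Qed.

Lemma opt_sdp2_cut_le1 (r s : 'I_81) :
  (opt_sdp2 r s (cut_metric R (side s W)) <= 1)%E.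
Proof.
have cWC : #|~: W| = 70%N.
  by apply: (@addnI #|W|); rewrite cardsC card_ord card_W.
apply: (le_trans (@opt_sdp2_cut_le R 78 h W r s _ _ _ _ _ _)).
- by rewrite card_W.
- by rewrite cWC.
- by rewrite card_W.
- by move=> t; rewrite ler0n.
- by rewrite sum_sqr_trapezoid ltr0n.
- by rewrite sum_trapezoid sum_sqr_trapezoid card_W; ring.
(* The bound is 10/160 * 10 + 2 * 10/80 = 7/8. *)
rewrite sum_sqr_trapezoid sum_sqr_diff_trapezoid card_W lee_fin; lra.
Qed.

Lemma gap_instance (r s : 'I_81) : let D := cut_metric R (side s W) in
  opt_tsp D != 0 /\ (2%:E <= (opt_tsp D)%:E / opt_sdp2 r s D)%E.
Proof.
move=> D; have D2 : 2 <= opt_tsp D.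
  apply: (@cut_metric_tour R 81 _ _ (lift s ord0) s).
    by rewrite side_lift inE.
  by rewrite side0.
split; first by rewrite gt_eqF // (lt_le_trans _ D2).
have := opt_sdp2_cut_le1 r s; rewrite -/D.
have := opt_sdp2_ge0 r s (cut_metric_instance R (side s W)); rewrite -/D.
case: (opt_sdp2 r s D) => [x|//|//]; rewrite !lee_fin => x0 x1.
(* A zero SDP value makes the ratio +oo; otherwise x is in (0, 1] and the tour cost is at least
   2. *)
have [->|xn0] := eqVneq x 0.
  by rewrite inve0 gt0_muley ?leey // lte_fin (lt_le_trans _ D2).
rewrite inver (negbTE xn0) -EFinM lee_fin ler_pdivlMr ?lt0r ?xn0 //.
apply: le_trans D2; lra.
Qed.

End Trapezoid.

Theorem corollary3p10 (R : realType) (r s : forall n : nat, 'I_n.+1) :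
  (2%:R%:E <= sdp2_integrality_gap R r s)%E.
Proof.
(* The single size n = 80 suffices, whatever indices are fixed there. *)
have [D0 Dgap] := gap_instance R (r 80) (s 80).
apply: (Order.POrderTheory.le_trans Dgap); apply: ereal_sup_ubound.
do 2!eexists; split; last reflexivity; [by [] | | exact: D0].
exact: cut_metric_instance.
Qed.
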